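(* There exist constants $c_1,c_2>0$ such that for every $N$, every path $G=(V,E)$ with $N$ vertices, and every $\epsilon\in[0,1]$, \[ P_\epsilon\bigl(\nu_\epsilon(G)<(1-c_1\,\epsilon)N\bigr)\ \le\ \exp(-c_2\,\epsilon N). \] (In particular $c_1,c_2$ do not depend on $N$ and $\epsilon$.)
   Context: A path is a finite connected graph in which two of the vertices have degree 1 and all others have degree 2. Opinion dynamics with confidence threshold $\epsilon\in[0,1]$ on a finite connected graph $G=(V,E)$: $(\eta_t)_{t\ge0}$ is the continuous-time pure-jump Markov process with state space $[0,1]^V$, where $\eta_t(x)$ is the opinion of vertex $x$ at time $t$. For each ordered pair $(x,y)$ of adjacent vertices, independently at rate $1$ (at the points of independent Poisson processes), vertex $y$ adopts the opinion of $x$ (i.e. $\eta(y)$ is replaced by $\eta(x)$) if $|\eta(x)-\eta(y)|\le\epsilon$; otherwise nothing happens. $P_\epsilon$ denotes the law of the process with parameter $\epsilon$ started from the random configuration in which $\eta_0(x)$, $x\in V$, are independent and uniformly distributed on $[0,1]$. Since the number of distinct opinions $\operatorname{card}\{\eta_t(x):x\in V\}$ is nonincreasing in $t$, it has a limit; $\nu_\epsilon(G)$ is the random variable $\lim_{t\to\infty}\operatorname{card}\{\eta_t(x):x\in V\}$, the number of opinions coexisting at equilibrium. *)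

(* Defs.v *)
From mathcomp Require Import all_boot all_order all_algebra finmap.
From mathcomp Require Import all_classical all_reals all_analysis.

Set Implicit Arguments.
Unset Strict Implicit.
Unset Printing Implicit Defensive.

Import Order.TTheory GRing.Theory Num.Theory.
Import numFieldNormedType.Exports.

Local Open Scope classical_set_scope.
Local Open Scope ring_scope.

(* A simple graph on V is given by its adjacency relation e. *)

Definition simple_graph (V : finType) (e : rel V) : Prop :=
  symmetric e /\ irreflexive e.

Definition connected_graph (V : finType) (e : rel V) : Prop :=
  forall x y : V, connect e x y.

Definition degree (V : finType) (e : rel V) (x : V) : nat :=
  #|[set y | e x y]%SET|.

Definition is_path (V : finType) (e : rel V) : Prop :=
  [/\ simple_graph e,
      connected_graph e,
      #|[set x | degree e x == 1%N]%SET| = 2%N &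
      forall x : V, degree e x != 1%N -> degree e x = 2%N].

(* Ordered pairs of adjacent vertices; each one carries its own clock. *)
Notation adjpair e := {a | e a.1 a.2}.

Definition mutually_independent (R : realType) (d : measure_display)
    (T : measurableType d) (P : probability T R) (I : choiceType)
    (X : I -> {RV P >-> R}) : Prop :=
  forall (J : {fset I}) (B : I -> set R),
    (forall i, measurable (B i)) ->
    P (\bigcap_(i in [set` J]) X i @^-1` B i) =
    (\prod_(i <- J) P (X i @^-1` B i))%E.

(* Laws are compared on measurable sets only: the values taken elsewhere by
   the underlying functions on sets carry no meaning. *)
Definition has_law (R : realType) (d : measure_display)
    (T : measurableType d) (P : probability T R)
    (X : {RV P >-> R}) (mu : set R -> \bar R) : Prop :=
  forall B : set R, measurable B -> distribution P X B = mu B.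

(* The n-th point (n = 0, 1, ...) of the point process with gaps tau. *)
Definition arrival (R : realType) (tau : nat -> R) (n : nat) : R :=
  \sum_(0 <= k < n.+1) tau k.

(* The configuration obtained when y = a.2 tries to imitate x = a.1. *)
Definition imitate (R : realType) (V : finType) (eps : R) (a : V * V)
    (c : V -> R) : V -> R :=
  fun z => if (z == a.2) && (`|c a.1 - c a.2| <= eps) then c a.1 else c z.

(* Trajectories of a pure-jump process on [0, +oo[: right-continuous with left
   limits for the discrete topology on configurations, that is, piecewise
   constant with finitely many jumps in each bounded time interval. *)
Definition pure_jump (R : realType) (V : finType) (f : R -> V -> R) : Prop :=
  (forall t : R, 0 <= t -> \forall s \near t^'+, f s = f t) /\
  (forall t : R, 0 < t -> exists c : V -> R, \forall s \near t^'-, f s = c).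

(* eta is the opinion process on (V, e) with threshold eps driven by the clocks
   tau: tau a n is the n-th waiting time of the clock of the pair a, so that
   i.i.d. exponential gaps of parameter 1 make these clocks independent Poisson
   processes of rate 1. Only times t >= 0 are relevant. The update rule can
   only be required almost surely, since on a null event several clocks may
   ring simultaneously or infinitely often in bounded time. *)
Record opinion_dynamics (R : realType) (d : measure_display)
    (T : measurableType d) (P : probability T R) (V : finType) (e : rel V)
    (eps : R) (tau : adjpair e -> nat -> {RV P >-> R})
    (eta : R -> V -> {RV P >-> R}) : Prop := OpinionDynamics {
  od_state : forall (t : R) x w, 0 <= t -> 0 <= eta t x w <= 1 ;
  od_pure_jump : forall w, pure_jump (fun t x => eta t x w) ;
  od_initial_law :
    forall x, has_law (eta 0 x) (@uniform_prob R 0 1 ltr01) ;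
  od_gap_law :
    forall a n, has_law (tau a n) (@exponential_prob R 1) ;
  od_independent :
    mutually_independent (fun i : V + adjpair e * nat =>
      match i with
      | inl x => eta 0 x
      | inr (a, n) => tau a n
      end) ;
  od_ring : {ae P, forall w, forall a n,
    let t := arrival (fun k => tau a k w) n in
    \forall s \near t^'-,
      (fun x => eta t x w) = imitate eps (val a) (fun x => eta s x w)} ;
  od_no_ring : {ae P, forall w, forall s t : R,
    0 <= s -> s <= t ->
    (forall a n, ~ (s < arrival (fun k => tau a k w) n <= t)) ->
    (fun x => eta t x w) = (fun x => eta s x w)}
}.

Definition nb_opinions (R : realType) (V : finType) (c : V -> R) : nat :=
  size (undup (codom c)).

(* The number of opinions coexisting at equilibrium. *)
Definition nu (R : realType) (T : Type) (V : finType)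
    (eta : R -> V -> T -> R) (w : T) : R :=
  lim (((nb_opinions (fun x => eta t x w))%:R : R) @[t --> +oo]).

(* Main.v *)
Require Import Defs.
From mathcomp Require Import all_boot all_order all_algebra finmap.
From mathcomp Require Import all_classical all_reals all_analysis.
From mathcomp Require Import measurable_realfun.
From mathcomp Require Import zify ring lra.
Import Order.TTheory GRing.Theory Num.Theory.
Import numFieldNormedType.Exports.
Local Open Scope classical_set_scope.
Local Open Scope ring_scope.

Set Implicit Arguments.
Unset Strict Implicit.
Unset Printing Implicit Defensive.

(** On a path the vertices sharing an opinion form an interval, and the
left-to-right order of the surviving opinions is that of the vertices where
they started. The dynamics therefore only deletes letters from the word of
initial opinions, and a letter is deleted only while it stands next to a letter
at distance at most eps in the word of survivors ([spread_reduct_imitate]).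
Nothing else about the clocks matters, except that almost surely the
configuration changes by single imitations ([jump_is_imitation]) and that the
initial opinions are distinct, so that opinions can be counted as letters. The
theorem follows from a bound, for a random word, on the number of letters that
the most destructive sequence of deletions can remove.

Between two consecutive survivors the deaths are recorded by a binary tree: the
last letter k to die splits the block into two blocks that died with k as a
wall, and k is close to one of its own two walls ([dies]). A random letter is
close to one of two given letters with probability at most kappa = O(eps), and
the two sub-blocks are independent given k. So the worst probability gap n that
a block of n letters dies satisfies the Catalan recursion
gap (n+1) <= kappa * sum_k gap k * gap (n-k) ([gap_rec]), and its generating
function at theta is at most 1 + 4 kappa theta as soon as 4 kappa theta <= 1
([gap_gf_le]). Decomposing the word at its survivors gives
theta^m * P(m letters can be lost) <= (1 + 4 kappa theta)^(N+1) ([prob_lost]).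
With theta = e the right-hand side is exp(O(eps N)), which is beaten by
e^m = exp(m) when m > c1 eps N for a large enough constant c1.

To have only finite sums to handle, opinions are rounded to K = floor(1/eps)
cells of length 1/K >= eps. Opinions at distance at most eps fall in the same
cell or in neighbouring ones, each cell has probability at most 1/K <= 2 eps,
and the word of cells is dominated by a uniform word ([word_prob]). *)

(** * Deletions in words *)

Section reductions.
Variables (A : Type) (close : A -> A -> Prop).

(** [dies close l s r]: all of [s] can be deleted between two letters [l] and [r]
that stay alive throughout. In [dies_cat] the letter [k] is the last one to die,
so it serves as a wall for both halves before one of the outer walls kills it. *)
Inductive dies : A -> seq A -> A -> Prop :=
| dies_nil l r : dies l [::] r
| dies_cat l s1 k s2 r : dies l s1 k -> dies k s2 r ->
    close l k \/ close k r -> dies l (s1 ++ k :: s2) r.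

(** [reduces close l s t r]: [s] can be cut down to [t], each gap between
consecutive survivors being emptied independently of the others. The walls [l]
and [r] stand for the two ends of the word; letting them kill too only makes
more reductions possible and spares a separate treatment of the ends. *)
Inductive reduces : A -> seq A -> seq A -> A -> Prop :=
| reduces_nil l s r : dies l s r -> reduces l s [::] r
| reduces_cons l s1 k s2 t r : dies l s1 k -> reduces k s2 t r ->
    reduces l (s1 ++ k :: s2) (k :: t) r.

Lemma reduces_refl l s r : reduces l s s r.
Proof.
elim: s l => [|x s IHs] l; first exact/reduces_nil/dies_nil.
by rewrite -[x :: s]cat0s; apply: reduces_cons (IHs x); apply: dies_nil.
Qed.

Lemma reducesP l s t r : reduces l s t r ->
  (t = [::] /\ dies l s r) \/
  exists s1 k s2 t', [/\ s = s1 ++ k :: s2, t = k :: t', dies l s1 k &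
                         reduces k s2 t' r].
Proof. by move=> h; inversion h; subst; [left | right; repeat eexists]. Qed.

(** The gaps on the two sides of [b] merge into one in which [b] dies last. *)
Lemma reduces_kill_right l s t1 a b t2 r : close a b ->
  reduces l s (t1 ++ a :: b :: t2) r -> reduces l s (t1 ++ a :: t2) r.
Proof.
move=> ab; elim: t1 l s => [|x t1 IHt] l s /= /reducesP[[//]|].
  move=> [s1 [_ [s2 [_ [-> [<- <-] d1 /reducesP[[//]|]]]]]].
  move=> [s3 [_ [s4 [_ [-> [<- <-] d3 h]]]]].
  apply: reduces_cons => //.
  case/reducesP: h => [[-> d4]|[s5 [c [s6 [t' [-> -> d5 h]]]]]].
    by apply: reduces_nil; apply: dies_cat => //; left.
  rewrite -cat_cons catA; apply: reduces_cons => //.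
  by apply: dies_cat => //; left.
move=> [s1 [_ [s2 [_ [-> [<- <-] d1 h]]]]].
by apply: reduces_cons => //; apply: IHt.
Qed.

Lemma reduces_kill_left l s t1 a b t2 r : close a b ->
  reduces l s (t1 ++ a :: b :: t2) r -> reduces l s (t1 ++ b :: t2) r.
Proof.
move=> ab; elim: t1 l s => [|x t1 IHt] l s /= /reducesP[[//]|].
  move=> [s1 [_ [s2 [_ [-> [<- <-] d1 /reducesP[[//]|]]]]]].
  move=> [s3 [_ [s4 [_ [-> [<- <-] d3 h]]]]].
  rewrite -cat_cons catA; apply: reduces_cons => //.
  by apply: dies_cat => //; right.
move=> [s1 [_ [s2 [_ [-> [<- <-] d1 h]]]]].
by apply: reduces_cons => //; apply: IHt.
Qed.

(** [spreads t c]: [c] repeats each letter of [t] one or more times in a row. Here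
[c] lists the opinions along the path and [t] the surviving opinions. *)
Inductive spreads : seq A -> seq A -> Prop :=
| spreads_nil : spreads [::] [::]
| spreads_new a t c : spreads t c -> spreads (a :: t) (a :: c)
| spreads_rep a t c : spreads (a :: t) c -> spreads (a :: t) (a :: c).

Lemma spreads_refl t : spreads t t.
Proof. by elim: t => [|a t]; [exact: spreads_nil | exact: spreads_new]. Qed.

Lemma spreads_cat t1 c1 t2 c2 :
  spreads t1 c1 -> spreads t2 c2 -> spreads (t1 ++ t2) (c1 ++ c2).
Proof.
move=> + h2; elim=> [//|a t c _ IH|a t c _ IH]; first exact: spreads_new.
exact: spreads_rep.
Qed.

Lemma spreads_consP t a c : spreads t (a :: c) ->
  exists t', t = a :: t' /\ (spreads t' c \/ spreads t c).
Proof. by move=> h; inversion h; subst; eexists; split; eauto. Qed.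

Lemma spreads_nilP t : spreads t [::] -> t = [::].
Proof. by move=> h; inversion h. Qed.

Lemma spreads_head_rep t b c : spreads t (b :: c) -> spreads t (b :: b :: c).
Proof.
by move=> h; have [t' [tE _]] := spreads_consP h; rewrite tE in h *;
  apply: spreads_rep.
Qed.

(** Two distinct neighbours belong to different runs, so the boundary between
them is also a cutting point of the word of survivors. *)
Lemma spreads_split t c1 a b c2 : a <> b ->
  spreads t (c1 ++ a :: b :: c2) ->
  exists t1 t2, [/\ t = t1 ++ t2, spreads t1 (rcons c1 a) & spreads t2 (b :: c2)].
Proof.
move=> ab; elim: c1 t => [|x c1 IH] t /= /spreads_consP[t' [-> [h|h]]].
- exists [:: a], t'; split => //; exact: spreads_refl.
- by have [? [[/ab]]] := spreads_consP h.
- have [t1 [t2 [-> h1 h2]]] := IH _ h.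
  exists (x :: t1), t2; split => //; exact: spreads_new.
- have [[|y t1] [t2 [tE h1 h2]]] := IH _ h.
    by case: (c1) h1 => [|? ?] h1; inversion h1.
  move: tE h1 => [<- ->] h1; exists (x :: t1), t2; split => //.
  exact: spreads_rep.
Qed.

(** Removing the last entry either leaves its run nonempty or removes the letter. *)
Lemma spreads_rcons t c a : spreads t (rcons c a) ->
  exists t', t = rcons t' a /\ (spreads t c \/ spreads t' c).
Proof.
elim: c t => [|x c IH] t /= /spreads_consP[t' [-> [h|h]]].
- rewrite (spreads_nilP h); exists [::]; split => //; right; exact: spreads_nil.
- by have := spreads_nilP h.
- have [t'' [-> [h1|h1]]] := IH _ h.
  + by exists (x :: t''); split => //; left; apply: spreads_new.
  + by exists (x :: t''); split => //; right; apply: spreads_new.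
- have [[|y t''] [tE [h1|h1]]] := IH _ h.
  + by exists [::]; split=> //; left; apply: spreads_rep.
  + move: tE => [-> ->]; exists [::]; split => //; left.
    case: c h1 {IH h} => [_|? ? /spreads_consP[? []//]].
    exact: spreads_refl.
  + by exists (y :: t''); split => //; left; apply: spreads_rep.
  + move: tE h1 => [<- ->] h1; exists (x :: t''); split => //; right.
    exact: spreads_rep.
Qed.

Lemma spreads_rcons_rep t c a :
  spreads t (rcons c a) -> spreads t (rcons (rcons c a) a).
Proof.
elim: c t => [|x c IH] t /= /spreads_consP[t' [-> [h|h]]].
- by rewrite (spreads_nilP h); apply: spreads_rep; apply: spreads_refl.
- by have := spreads_nilP h.
- by apply: spreads_new; apply: IH.
- by apply: spreads_rep; apply: IH.
Qed.

(** The invariant of the dynamics, with [s] the initial word of opinions and [c]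
the current one. *)
Definition spread_reduct l s r c := exists2 t, reduces l s t r & spreads t c.

(** When an entry is overwritten by its left neighbour, the run it belonged to
either shrinks or disappears, and in the second case the letter is killed by an
adjacent survivor. *)
Lemma spread_reduct_right l s r c1 a b c2 : close a b ->
  spread_reduct l s r (c1 ++ a :: b :: c2) ->
  spread_reduct l s r (c1 ++ a :: a :: c2).
Proof.
have [->//|ab'] := pselect (a = b).
move=> ab [t st tc].
have [t1 [t2 [tE h1 h2]]] := spreads_split ab' tc.
have [t1' [t1E _]] := spreads_rcons h1.
have h1' := spreads_rcons_rep h1.
have cE : rcons (rcons c1 a) a ++ c2 = c1 ++ a :: a :: c2.
  by rewrite !cat_rcons.
have [t2' [t2E [h|h]]] := spreads_consP h2; subst.
- exists (rcons t1' a ++ t2'); last by rewrite -cE; apply: spreads_cat.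
  by move: st; rewrite !cat_rcons; exact: reduces_kill_right.
- by exists (rcons t1' a ++ b :: t2') => //; rewrite -cE; apply: spreads_cat.
Qed.

Lemma spread_reduct_left l s r c1 a b c2 : close a b ->
  spread_reduct l s r (c1 ++ a :: b :: c2) ->
  spread_reduct l s r (c1 ++ b :: b :: c2).
Proof.
have [->//|ab'] := pselect (a = b).
move=> ab [t st tc].
have [t1 [t2 [tE h1 h2]]] := spreads_split ab' tc.
have h2' := spreads_head_rep h2.
have [t2' [t2E _]] := spreads_consP h2.
have [t1' [t1E [h|h]]] := spreads_rcons h1; subst.
- by exists (rcons t1' a ++ b :: t2') => //; apply: spreads_cat.
- exists (t1' ++ b :: t2'); last exact: spreads_cat.
  by move: st; rewrite cat_rcons; exact: reduces_kill_left.
Qed.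

End reductions.

Section reductions_map.
Variables (A B : Type) (closeA : A -> A -> Prop) (closeB : B -> B -> Prop).
Variable f : A -> B.
Hypothesis f_close : forall a b, closeA a b -> closeB (f a) (f b).

Lemma dies_map l s r : dies closeA l s r -> dies closeB (f l) (map f s) (f r).
Proof.
elim=> [*|*]; first exact: dies_nil.
by rewrite map_cat /=; apply: dies_cat => //; intuition.
Qed.

Lemma reduces_map l s t r : reduces closeA l s t r ->
  reduces closeB (f l) (map f s) (map f t) (f r).
Proof.
elim=> [? ? ? h|? ? ? ? ? ? h _ IH]; first exact/reduces_nil/dies_map.
by rewrite map_cat /=; apply: reduces_cons => //; exact: dies_map.
Qed.

End reductions_map.

Lemma reduces_subseq (A : eqType) (close : A -> A -> Prop) l s t r :
  reduces close l s t r -> subseq t s.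
Proof.
elim=> [*|? s1 k s2 ? ? _ _ IH]; first exact: sub0seq.
by apply: (subseq_trans _ (suffix_subseq s1 _)); rewrite /= eqxx.
Qed.

Lemma spreads_mem (A : eqType) (t c : seq A) : spreads t c -> t =i c.
Proof.
elim=> [//|a t' c' _ IH|a t' c' _ IH] x; rewrite !inE; first by rewrite IH.
by rewrite -IH inE orbA orbb.
Qed.

(** * Deletions in random words *)

Lemma sum_triangle (R : nmodType) (F : nat -> nat -> R) n :
  \sum_(m < n) \sum_(k < m.+1) F k (m - k)%N =
  \sum_(k < n) \sum_(j < n - k) F k j.
Proof.
elim: n => [|n IH]; first by rewrite !big_ord0.
rewrite big_ord_recr IH /= [RHS]big_ord_recr /= subSnn big_ord1.
rewrite [X in _ + X = _]big_ord_recr /= subnn addrA; congr (_ + _).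
rewrite -big_split; apply: eq_bigr => i _ /=.
by rewrite subSn 1?ltnW// big_ord_recr.
Qed.

Section random_words.
Variables (R : realType) (T : finType).
Local Notation q := (#|T|%:R : R).

(** The average of [f] over all words of length [n]; the recursive form lets words
be split at any position by computation on the length. *)
Fixpoint avg n (f : seq T -> R) : R :=
  if n is n'.+1 then (\sum_k avg n' (fun s => f (k :: s))) / q else f [::].

Lemma avg_le n f g : (forall s, size s = n -> f s <= g s) -> avg n f <= avg n g.
Proof.
elim: n f g => [|n IH] f g fg /=; first exact: fg.
rewrite ler_wpM2r ?invr_ge0// ler_sum// => k _.
by apply: IH => s sn; apply: fg; rewrite /= sn.
Qed.

Lemma eq_avg n f g : (forall s, size s = n -> f s = g s) -> avg n f = avg n g.
Proof. by move=> fg; apply/le_anti; rewrite !avg_le// => s /fg ->. Qed.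

Lemma avg_sum n I (r : seq I) (F : I -> seq T -> R) :
  avg n (fun s => \sum_(i <- r) F i s) = \sum_(i <- r) avg n (F i).
Proof.
elim: n F => [//|n IH] F /=; rewrite -mulr_suml; congr (_ / _).
by rewrite exchange_big; apply: eq_bigr => k _; rewrite IH.
Qed.

Lemma avgZ n c f : avg n (fun s => c * f s) = c * avg n f.
Proof.
elim: n f => [//|n IH] f /=; rewrite mulrA mulr_sumr; congr (_ / _).
by apply: eq_bigr => k _; rewrite IH.
Qed.

Lemma avg_cat m n f :
  avg (m + n) f = avg m (fun s1 => avg n (fun s2 => f (s1 ++ s2))).
Proof. by elim: m f => [//|m IH] f /=; under eq_bigr do rewrite IH. Qed.

(** Given the letter at position [k], the two parts of a uniform word around it are
independent. *)
Lemma avg_split k j f (h : T -> R) g1 g2 :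
  (forall s1 x s2, size s1 = k -> size s2 = j ->
     f (s1 ++ x :: s2) <= h x * (g1 x s1 * g2 x s2)) ->
  avg (k + j.+1) f <= (\sum_x h x * (avg k (g1 x) * avg j (g2 x))) / q.
Proof.
move=> fle; rewrite avg_cat /=.
have -> : (\sum_x h x * (avg k (g1 x) * avg j (g2 x))) / q =
    avg k (fun s1 => \sum_x (h x * avg j (g2 x) / q) * g1 x s1).
  rewrite avg_sum mulr_suml; apply: eq_bigr => x _; rewrite avgZ.
  by ring.
apply: avg_le => s1 s1k; rewrite mulr_suml ler_sum// => x _.
rewrite mulrAC ler_wpM2r ?invr_ge0// mulrAC -avgZ avg_le// => s2 s2j.
by rewrite -mulrA; exact: fle.
Qed.

Definition prob n (Q : seq T -> Prop) : R := avg n (fun s => `[< Q s >]%:R).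

Lemma prob_ge0 n Q : 0 <= prob n Q.
Proof.
suff: forall f, (forall s, 0 <= f s) -> 0 <= avg n f by apply.
elim: n => [|n IH] f f0 /=; first exact: f0.
by rewrite divr_ge0// sumr_ge0// => k _; apply: IH.
Qed.

Lemma prob_le n (Q1 Q2 : seq T -> Prop) :
  (forall s, size s = n -> Q1 s -> Q2 s) -> prob n Q1 <= prob n Q2.
Proof.
move=> Q12; apply: avg_le => s sn; rewrite ler_nat.
by case: asboolP => // /(Q12 _ sn)/asboolP ->.
Qed.

Lemma prob_or n (Q1 Q2 : seq T -> Prop) :
  prob n (fun s => Q1 s \/ Q2 s) <= prob n Q1 + prob n Q2.
Proof.
have -> : prob n Q1 + prob n Q2 =
    avg n (fun s => \sum_(b : bool) `[< (if b then Q1 else Q2) s >]%:R).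
  by rewrite avg_sum big_bool.
apply: avg_le => s _; rewrite big_bool /= -natrD ler_nat.
case: asboolP => // -[/asboolP ->|/asboolP ->]; first by [].
by rewrite addn1.
Qed.

Lemma prob_eq0 n (Q : seq T -> Prop) :
  (forall s, size s = n -> ~ Q s) -> prob n Q = 0.
Proof.
move=> nQ; have -> : 0 = avg n (fun=> 0 * 0) by rewrite avgZ mul0r.
by apply: eq_avg => s sn; rewrite mul0r asboolF//; exact: nQ.
Qed.

Lemma prob_exists n m (Q : nat -> seq T -> Prop) :
  prob n (fun s => exists2 k, (k < m)%N & Q k s) <= \sum_(k < m) prob n (Q k).
Proof.
elim: m => [|m IH].
  by rewrite big_ord0 prob_eq0// => s _ [].
rewrite big_ord_recr /=; apply: le_trans (lerD IH (lexx _)).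
apply: le_trans (prob_or _ _ _); apply: prob_le => s _ [k].
rewrite ltnS leq_eqVlt => /orP[/eqP ->|km] Qk; first by right.
by left; exists k.
Qed.

Lemma prob_le1 n Q : (0 < #|T|)%N -> prob n Q <= 1.
Proof.
move=> T0; apply: (@le_trans _ _ (avg n (fun=> 1))).
  by apply: avg_le => s _; rewrite lern1 leq_b1.
elim: n => [//|n IH] /=; rewrite sumr_const -[X in X / _]mulr_natl.
by rewrite ler_pdivrMr ?ltr0n// mulrC ler_wpM2r.
Qed.

Variables (close : rel T) (D : nat).
Hypothesis T_gt0 : (0 < #|T|)%N.
Hypothesis close_sym : symmetric close.
Hypothesis close_le : forall l, (#|close l| <= D)%N.

(** A bound for the probability that a uniform letter is close to one of two given
letters, see [sum_close]. *)
Definition kappa : R := D.*2%:R / q.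

(** Taking the worst pair of walls makes the recursion close on a single sequence:
after conditioning on the last letter to die, that letter becomes a wall. *)
Definition gap n : R :=
  \big[Num.max/0]_(lr : T * T) prob n (fun s => dies close lr.1 s lr.2).

Lemma gap_ge0 n : 0 <= gap n.
Proof. exact: bigmax_ge_id. Qed.

Lemma prob_dies l r n : prob n (fun s => dies close l s r) <= gap n.
Proof. exact: (le_bigmax _ _ (l, r)). Qed.

Lemma kappa_ge0 : 0 <= kappa.
Proof. by rewrite divr_ge0. Qed.

Lemma sum_close l r : (\sum_x (close l x || close x r)%:R) / q <= kappa.
Proof.
rewrite ler_wpM2r ?invr_ge0// -natr_sum ler_nat -addnn.
apply: (@leq_trans (#|close l| + #|close r|)).
  rewrite -!sum1_card [X in (_ <= X + _)%N]big_mkcond.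
  rewrite [X in (_ <= _ + X)%N]big_mkcond -big_split leq_sum// => x _ /=.
  by rewrite ![_ \in close _]unfold_in (close_sym x); case: close; case: close.
exact: leq_add.
Qed.

(** Union bound over the position of the last letter to die, which has to be close
to one of the outer walls. *)
Lemma gap_rec n : gap n.+1 <= kappa * \sum_(k < n.+1) gap k * gap (n - k).
Proof.
apply/bigmax_leP; split => [|[l r] _ /=].
  by rewrite mulr_ge0 ?kappa_ge0// sumr_ge0// => *; rewrite mulr_ge0 ?gap_ge0.
pose Q k s := exists s1 x s2, [/\ s = s1 ++ x :: s2, size s1 = k,
  dies close l s1 x, dies close x s2 r & close l x || close x r].
apply: (@le_trans _ _ (prob n.+1 (fun s => exists2 k, (k < n.+1)%N & Q k s))).
  apply: prob_le => s sn d; inversion d; subst; first by [].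
  exists (size s1); first by rewrite -sn size_cat/=; lia.
  by exists s1, k, s2; split => //; apply/orP.
apply: (le_trans (prob_exists _ _ _)); rewrite mulr_sumr ler_sum// => -[k kn] _ /=.
have -> : n.+1 = (k + (n - k).+1)%N by lia.
apply: (@le_trans _ _ ((\sum_x (close l x || close x r)%:R *
    (prob k (fun s => dies close l s x) *
     prob (n - k) (fun s => dies close x s r))) / q)).
  apply: avg_split => s1 x s2 s1k s2k.
  case: asboolP => [[s1' [x' [s2' [/eqP sE s1'k d1 d2 c]]]]|_].
    move: sE; rewrite eqseq_cat ?s1'k// => /andP[/eqP s1E /eqP[xE s2E]].
    rewrite s1E xE s2E c; move/asboolP: d1 => ->; move/asboolP: d2 => ->.
    by rewrite !mulr1.
  by rewrite !mulr_ge0.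
apply: (@le_trans _ _ ((\sum_x (close l x || close x r)%:R *
    (gap k * gap (n - k))) / q)).
  rewrite ler_wpM2r ?invr_ge0// ler_sum// => x _; rewrite ler_wpM2l//.
  by rewrite ler_pM ?prob_ge0 ?prob_dies.
by rewrite -mulr_suml mulrAC ler_wpM2r ?sum_close// mulr_ge0 ?gap_ge0.
Qed.

Variable theta : R.
Hypothesis theta_ge1 : 1 <= theta.
Hypothesis kappa_theta : 4 * kappa * theta <= 1.
Let theta_ge0 : 0 <= theta := le_trans ler01 theta_ge1.

Definition gap_gf n : R := \sum_(k < n) gap k * theta ^+ k.

Lemma gap_gf_ge0 n : 0 <= gap_gf n.
Proof. by apply: sumr_ge0 => k _; rewrite mulr_ge0 ?gap_ge0 ?exprn_ge0. Qed.

Lemma gap0 : gap 0 <= 1.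
Proof. by apply/bigmax_leP; split => // lr _; exact: prob_le1. Qed.

(** The generating function form of the Catalan recursion. *)
Lemma gap_gf_rec n : gap_gf n.+1 <= 1 + kappa * theta * gap_gf n ^+ 2.
Proof.
rewrite /gap_gf big_ord_recl /= expr0 mulr1 lerD ?gap0//.
apply: (@le_trans _ _ (kappa * theta * \sum_(m < n) \sum_(k < m.+1)
  (gap k * theta ^+ k) * (gap (m - k) * theta ^+ (m - k)))).
  rewrite mulr_sumr ler_sum// => -[m mn] _ /=.
  apply: (le_trans (ler_wpM2r (exprn_ge0 _ theta_ge0) (gap_rec m))).
  rewrite exprS mulrACA ler_wpM2l ?mulr_ge0 ?kappa_ge0// mulr_suml.
  rewrite ler_sum// => -[k km] _ /=.
  by rewrite [leRHS]mulrACA -exprD subnKC.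
rewrite ler_wpM2l ?mulr_ge0 ?kappa_ge0//.
rewrite (sum_triangle
  (fun k j => (gap k * theta ^+ k) * (gap j * theta ^+ j))).
rewrite expr2 mulr_suml ler_sum// => -[k kn] _ /=.
rewrite -mulr_sumr ler_wpM2l ?mulr_ge0 ?gap_ge0 ?exprn_ge0//.
move: (n - k)%N (leq_subr k n) => j /subnKC <-.
rewrite big_split_ord /= lerDl.
by apply: sumr_ge0 => i _; rewrite mulr_ge0 ?gap_ge0 ?exprn_ge0.
Qed.

Definition growth : R := 1 + 4 * kappa * theta.

Lemma growth_ge1 : 1 <= growth.
Proof. by rewrite lerDl !mulr_ge0 ?kappa_ge0. Qed.

(** If [gap_gf n <= 2] then its square is at most 4 and [gap_gf_rec] gives
[gap_gf n.+1 <= growth], which is again at most 2. *)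
Lemma gap_gf_le n : gap_gf n <= growth.
Proof.
have kt0 : 0 <= kappa * theta by rewrite mulr_ge0 ?kappa_ge0.
elim: n => [|n IH].
  by rewrite /gap_gf big_ord0 (le_trans _ growth_ge1).
have h0 := gap_gf_ge0 n.
have h2 : gap_gf n <= 2 by apply: le_trans IH _; rewrite /growth; have := kappa_theta; lra.
apply: (le_trans (gap_gf_rec n)); rewrite /growth lerD2l.
have : gap_gf n ^+ 2 <= 2 ^+ 2 by rewrite lerXn2r ?nnegrE.
move/(ler_wpM2l kt0); rewrite /growth; lra.
Qed.

Definition lost l m s r :=
  exists2 t, reduces close l s t r & (size t + m <= size s)%N.

(** Exponential Markov inequality for the number of lost letters: peeling off the
first survivor multiplies the bound by the generating function of the gap in
front of it, so a word of length [n] costs at most [growth] per gap. *)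
Lemma prob_lost n l r m :
  theta ^+ m * prob n (fun s => lost l m s r) <= growth ^+ n.+1.
Proof.
elim/ltn_ind: n l m => n IH l m.
have g1 := growth_ge1; have g0 := le_trans ler01 g1.
(* Q k: the first survivor is at position k, after k losses. The truncated
   difference m - k covers the case where these k losses already suffice. *)
pose Q k s := exists s1 x s2, [/\ s = s1 ++ x :: s2, size s1 = k,
  dies close l s1 x & lost x (m - k) s2 r].
apply: (@le_trans _ _ (theta ^+ m * (prob n (fun s => (m <= n)%N /\ dies close l s r) +
    \sum_(k < n) prob n (Q k)))).
  rewrite ler_wpM2l ?exprn_ge0//.
  apply: le_trans (lerD (lexx _) (prob_exists _ _ _)).
  apply: le_trans (prob_or _ _ _).
  apply: prob_le => s sn [t st tm].
  have [[tE d]|[s1 [k [s2 [t' [sE tE d h]]]]]] := reducesP st.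
    by left; split=> //; rewrite -sn; move: tm; rewrite tE.
  right; exists (size s1); first by rewrite -sn sE size_cat/=; lia.
  exists s1, k, s2; split => //; exists t' => //.
  have := size_subseq (reduces_subseq h).
  by move: tm; rewrite sE tE size_cat /=; lia.
rewrite mulrDr.
apply: (@le_trans _ _ (growth ^+ n * \sum_(k < n.+1) gap k * theta ^+ k)); last first.
  by rewrite exprSr ler_wpM2l ?exprn_ge0//; exact: gap_gf_le.
rewrite big_ord_recr /= mulrDr addrC lerD//.
  rewrite !mulr_sumr ler_sum// => -[k kn] _ /=.
  have -> : prob n (Q k) = prob (k + (n - k.+1).+1) (Q k).
    by congr prob; lia.
  have le1 : prob (k + (n - k.+1).+1) (Q k) <= (\sum_x 1 *
    (prob k (fun s => dies close l s x) *
     prob (n - k.+1) (fun s => lost x (m - k) s r))) / q.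
    apply: avg_split => s1 x s2 s1k s2k.
    case: asboolP => [[s1' [x' [s2' [/eqP sE s1'k d1 d2]]]]|_].
      move: sE; rewrite eqseq_cat ?s1'k// => /andP[/eqP s1E /eqP[xE s2E]].
      rewrite s1E xE s2E; move/asboolP: d1 => ->; move/asboolP: d2 => ->.
      by rewrite !mulr1.
    by rewrite !mulr_ge0.
  apply: (le_trans (ler_wpM2l (exprn_ge0 _ theta_ge0) le1)).
  rewrite [leLHS]mulrA ler_pdivrMr ?ltr0n// mulr_sumr.
  apply: (@le_trans _ _ (\sum_(x : T) growth ^+ n * (gap k * theta ^+ k))).
    apply: ler_sum => x _; rewrite mul1r.
    have -> : growth ^+ n * (gap k * theta ^+ k) =
        theta ^+ k * (gap k * growth ^+ n) by ring.
    have p1 := prob_dies l x k.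
    have p2 : theta ^+ (m - k) * prob (n - k.+1) (fun s => lost x (m - k) s r)
        <= growth ^+ n.
      apply: le_trans (IH (n - k.+1)%N _ _ _) _; first by lia.
      by rewrite ler_weXn2l//; lia.
    have p3 : theta ^+ m <= theta ^+ k * theta ^+ (m - k).
      by rewrite -exprD ler_weXn2l//; lia.
    apply: le_trans (ler_wpM2r _ p3) _.
      by rewrite mulr_ge0 ?prob_ge0.
    rewrite -mulrA ler_wpM2l ?exprn_ge0// mulrCA ler_pM ?prob_ge0//.
    by rewrite mulr_ge0 ?prob_ge0 ?exprn_ge0.
  by rewrite sumr_const -[X in X <= _]mulr_natr.
case: (leqP m n) => mn.
  rewrite [gap n * _]mulrC -[leLHS]mul1r.
  apply: ler_pM; rewrite ?mulr_ge0 ?prob_ge0 ?exprn_ge0 ?exprn_ege1//.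
  apply: ler_pM; rewrite ?prob_ge0 ?exprn_ge0//; first by rewrite ler_weXn2l.
  by apply: le_trans (prob_dies l r n); apply: prob_le => s _ [].
rewrite prob_eq0; last by move=> s _ [].
by rewrite mulr0 !mulr_ge0 ?gap_ge0 ?exprn_ge0.
Qed.

End random_words.

(** * Vertices of a path in order *)

Definition consecutive (A : Type) (s : seq A) (x y : A) :=
  exists s1 s2, s = s1 ++ x :: y :: s2 \/ s = s1 ++ y :: x :: s2.

Lemma consecutiveC (A : Type) (s : seq A) x y :
  consecutive s x y -> consecutive s y x.
Proof. by move=> [s1 [s2 [->|->]]]; exists s1, s2; [right|left]. Qed.

Section path_enumeration.
Variables (V : finType) (e : rel V).

Lemma path_edge u p s1 w x s2 :
  path e u p -> u :: p = s1 ++ w :: x :: s2 -> e w x.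
Proof.
elim: s1 u p => [|a s1 IH] u p /= pth [uE pE].
  by move: pth; rewrite uE pE /= => /andP[].
case: p pE pth => [|b p]; first by case: (s1).
by move=> pE /= /andP[_ pth]; apply: (IH b p).
Qed.

(** A vertex with a successor on a simple path from a leaf already has all its
neighbours on that path: its predecessor and successor exhaust its degree. *)
Lemma inner_neighbours u p s1 x z s2 y : simple_graph e ->
  degree e u = 1%N -> (degree e x <= 2)%N ->
  path e u p -> uniq (u :: p) -> u :: p = s1 ++ x :: z :: s2 -> e x y ->
  consecutive (u :: p) x y.
Proof.
move=> [es ei] du dx pth un sE exy.
have exz := path_edge pth sE.
case/lastP: s1 sE => [[ux pE]|s1 w sE].
  have yz : y = z.
    apply/eqP; move: du; rewrite /degree => /eqP/cards1P[v vE].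
    have : z \in [set v]%SET by rewrite -vE ux inE.
    have : y \in [set v]%SET by rewrite -vE ux inE.
    by rewrite !inE => /eqP -> /eqP ->.
  by rewrite pE yz; exists [::], s2; left; rewrite ux.
have ewx : e w x.
  by apply: (path_edge (s1 := s1) (s2 := z :: s2) pth); rewrite sE cat_rcons.
have wz : w != z.
  move: un; rewrite sE cat_rcons cat_uniq => /and3P[_ _] /= /andP[].
  by rewrite !inE !negb_or => /and3P[].
have /orP[/eqP ->|/eqP ->] : (y == w) || (y == z).
  apply: contraT; rewrite negb_or => /andP[yw yz].
  have : (#|[set w; z; y]%SET| <= degree e x)%N.
    apply/subset_leq_card/fintype.subsetP => v; rewrite !inE => /orP[/orP[]|] /eqP -> //.
    by rewrite es.
  rewrite -finset.setUA cardsU1 cards2 !inE (negbTE wz) ![_ == y]eq_sym (negbTE yw) (negbTE yz) /=.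
  by move=> h; have := leq_trans h dx.
- by exists s1, (z :: s2); right; rewrite sE cat_rcons.
- by exists (rcons s1 w), s2; left.
Qed.

(** A longest simple path from a leaf visits every vertex: it contains all the
neighbours of its inner vertices by [inner_neighbours], and those of its last
vertex by maximality, so connectedness leaves nothing outside. *)
Lemma is_path_enum : is_path e ->
  exists s : seq V, [/\ uniq s, forall x, x \in s &
    forall x y, e x y -> consecutive s x y].
Proof.
move=> [[es ei] ec leaves deg2].
have deg x : (degree e x <= 2)%N.
  by case: (eqVneq (degree e x) 1%N) => [->//|/deg2 ->].
have [u du] : exists u, degree e u = 1%N.
  have /card_gt0P[u] : (0 < #|[set x | degree e x == 1%N]%SET|)%N by rewrite leaves.
  by rewrite inE => /eqP; exists u.
pose P k := [exists t : k.-tuple V, path e u t && uniq (u :: t)].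
have exP : exists k, P k by exists 0%N; apply/existsP; exists [tuple].
have ubP k : P k -> (k <= #|V|)%N.
  move=> /existsP[t /andP[_ /card_uniqP ut]].
  by have := max_card (mem (u :: t)); rewrite ut /= size_tuple => /ltnW.
case: (ex_maxnP exP ubP) => k /existsP[t /andP[pth un]] kmax.
set p : seq V := t in pth un.
have inner s1 x z s2 y : u :: p = s1 ++ x :: z :: s2 -> e x y ->
    consecutive (u :: p) x y.
  by apply: inner_neighbours.
have consec x y : x \in u :: p -> e x y -> consecutive (u :: p) x y.
  move=> xp exy; have [s1 [s2 sE]] : exists s1 s2, u :: p = s1 ++ x :: s2.
    by case/splitPr: xp => s1 s2; exists s1, s2.
  case: s2 sE => [|z s2] sE; last exact: inner sE exy.
  have yp : y \in u :: p.
    apply: contraT => yp.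
    have : P k.+1.
      apply/existsP; exists [tuple of rcons t y].
      change (path e u (rcons p y) && uniq (rcons (u :: p) y)).
      rewrite rcons_uniq yp un rcons_path pth /= andbT.
      suff -> : last u t = x by [].
      by rewrite -[last u t]/(last x (u :: p)) sE last_cat.
    by move/kmax; rewrite ltnn.
  have [s1' [s2' sE']] : exists s1 s2, u :: p = s1 ++ y :: s2.
    by case/splitPr: yp => ? ?; eexists; eexists.
  case: s2' sE' => [|z s2'] sE'.
    have : last x (u :: p) = last x (u :: p) by [].
    rewrite {1}sE sE' !last_cat /= => xy; by move: exy; rewrite xy ei.
  by apply: consecutiveC; apply: inner sE' _; rewrite es.
have mem_consec x y : consecutive (u :: p) x y -> y \in u :: p.
  by move=> [s1 [s2 [->|->]]]; rewrite mem_cat !inE eqxx !orbT.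
have all_in v : v \in u :: p.
  have /connectP[q qp ->] := ec u v.
  have closed x r : x \in u :: p -> path e x r -> last x r \in u :: p.
    elim: r x => [//|a r IH] x xin /= /andP[xa ar].
    by apply: IH => //; apply: mem_consec (consec _ _ xin xa).
  by apply: closed qp; rewrite mem_head.
by exists (u :: p); split => // x y; apply: consec.
Qed.

End path_enumeration.

(** * Trajectories of the opinion dynamics *)

Section trajectories.
Variables (R : realType) (V : finType).
Implicit Type f : R -> V -> R.

(** Induction over continuous time: at the infimum of the times where the invariant
fails it still holds by the jump hypothesis, and right-continuity extends it
beyond. *)
Lemma pure_jump_induction f (Inv : (V -> R) -> Prop) s0 :
  pure_jump f -> 0 <= s0 -> Inv (f s0) ->
  (forall t, s0 < t -> (\forall s \near t^'-, Inv (f s)) -> Inv (f t)) ->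
  forall t, s0 <= t -> Inv (f t).
Proof.
move=> [rc _] s00 I0 Il t1 st1; apply: contrapT => It1.
pose A := [set t | s0 <= t /\ ~ Inv (f t)].
have A1 : A t1 by [].
have lbA : lbound A s0 by move=> t [].
have infA : has_inf A by split; [exists t1 | exists s0].
have s0inf : s0 <= inf A by apply: lb_le_inf => //; exists t1.
have before s : s0 <= s -> s < inf A -> Inv (f s).
  move=> s0s; apply: contraPP => nI; apply/negP; rewrite -leNgt.
  by apply: ge_inf; [exists s0 | split].
have Iinf : Inv (f (inf A)).
  move: s0inf; rewrite le_eqVlt => /orP[/eqP <-//|s0inf].
  apply: Il => //; near=> s; apply: before; last by near: s; exact: nbhs_left_lt.
  by near: s; exact: nbhs_left_ge.
have /nbhs_ballP[/= d d0 hd] := rc _ (le_trans s00 s0inf).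
have [a Aa ad] := inf_adherent d0 infA; have [s0a] := Aa.
apply; have : inf A <= a by apply: ge_inf => //; exists s0.
rewrite le_eqVlt => /orP[/eqP <-//|infa].
rewrite (_ : f a = f (inf A))//; apply: hd => //=.
rewrite -ball_normE /ball_ /=.
by rewrite distrC ger0_norm ?subr_ge0 1?ltW// ltrBlDl.
Unshelve. all: by end_near. Qed.

Variables (e : rel V) (eps : R).

(** If no clock rings at time t, then, clocks having finitely many points in bounded
time, none rings on a whole interval ending at t. If some clock rings at t, its
rule alone determines the jump, even when others ring simultaneously. *)
Lemma jump_is_imitation f (arr : adjpair e -> nat -> R) t :
  (forall a t', exists n0, forall n, (n0 <= n)%N -> t' < arr a n) ->
  (forall a n, \forall s \near (arr a n)^'-, f (arr a n) = imitate eps (val a) (f s)) ->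
  (forall s t', 0 <= s -> s <= t' -> (forall a n, ~ (s < arr a n <= t')) -> f t' = f s) ->
  0 < t ->
  (\forall s \near t^'-, f t = f s) \/
  exists a : adjpair e, \forall s \near t^'-, f t = imitate eps (val a) (f s).
Proof.
move=> far ring no_ring t0.
have [[a [n tE]]|noarr] := pselect (exists a n, arr a n = t).
  by right; exists a; rewrite -tE; exact: ring.
left.
have quiet : \forall s \near t^'-, forall a : adjpair e, forall n, ~ (s < arr a n <= t).
  apply: filter_forall => a; have [n0 farn] := far a t.
  have : \forall s \near t^'-, forall i : 'I_n0, ~ (s < arr a i <= t).
    apply: filter_forall => i; have [|art] := leP (arr a i) t; last first.
      by near=> s; rewrite andbF.
    rewrite le_eqVlt => /orP[/eqP ai|ait]; first by case: noarr; exists a, i.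
    near=> s; apply/negP; rewrite negb_and -leNgt; apply/orP; left.
    by near: s; exact: nbhs_left_ge.
  apply: filterS => s hs n; have [nn|/farn tn] := ltnP n n0.
    exact: (hs (Ordinal nn)).
  by move=> /andP[_]; rewrite leNgt tn.
near=> s; apply: no_ring.
- by near: s; exact: nbhs_left_ge.
- by apply: ltW; near: s; exact: nbhs_left_lt.
- by near: s.
Unshelve. all: by end_near. Qed.

Lemma opinion_induction f (Inv : (V -> R) -> Prop) s0 : pure_jump f ->
  (forall t, 0 < t -> (\forall s \near t^'-, f t = f s) \/
    exists a : adjpair e, \forall s \near t^'-, f t = imitate eps (val a) (f s)) ->
  0 <= s0 -> Inv (f s0) ->
  (forall x y c, e x y -> Inv c -> Inv (imitate eps (x, y) c)) ->
  forall t, s0 <= t -> Inv (f t).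
Proof.
move=> pj jump s00 I0 step; apply: pure_jump_induction => // t s0t nearI.
have [h|[[[x y] /= exy] h]] := jump t (le_lt_trans s00 s0t).
  near t^'- => s; have -> : f t = f s by near: s.
  by near: s.
near t^'- => s; have -> : f t = imitate eps (x, y) (f s) by near: s.
by apply: step => //; near: s.
Unshelve. all: by end_near. Qed.

(** The set of opinions present can only shrink, so their number reaches its
minimum at some time and stays there. *)
Lemma nu_attained (T : Type) (eta : R -> V -> T -> R) w :
  pure_jump (fun t x => eta t x w) ->
  (forall t, 0 < t -> (\forall s \near t^'-,
      (fun x => eta t x w) = (fun x => eta s x w)) \/
    exists a : adjpair e, \forall s \near t^'-,
      (fun x => eta t x w) = imitate eps (val a) (fun x => eta s x w)) ->
  exists2 t, 0 <= t & nu eta w = (nb_opinions (fun x => eta t x w))%:R.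
Proof.
move=> pj jump.
pose nb t := nb_opinions (fun x => eta t x w).
have noninc s t : 0 <= s -> s <= t -> (nb t <= nb s)%N.
  move=> s0 st.
  apply: (uniq_leq_size (undup_uniq _)) => v; rewrite !mem_undup.
  move: v; have := @opinion_induction (fun t x => eta t x w)
    (fun c => {subset codom c <= codom (fun x => eta s x w)}) s pj jump s0.
  apply=> // x y c exy sub v /codomP[z ->]; apply: sub.
  by rewrite /imitate; case: ifP => _; exact: codom_f.
have exk : exists k, `[< exists2 t, 0 <= t & nb t = k >].
  by exists (nb 0); apply/asboolP; exists 0.
case: (ex_minnP exk) => k /asboolP[t0 t00 kE] kmin.
exists t0 => //; rewrite /nu; apply/cvg_lim => //.
apply: cvg_near_cst; near=> t; congr (_%:R).
have t0t : t0 <= t by near: t; apply: nbhs_pinfty_ge; exact: num_real.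
apply/eqP; rewrite -/(nb t) -/(nb t0) kE eqn_leq -{1}kE noninc//= kmin//.
by apply/asboolP; exists t => //; exact: le_trans t0t.
Unshelve. all: by end_near. Qed.

Definition near_opinions (x y : R) : Prop := `|x - y| <= eps.

(** The invariant is kept by every imitation along an edge, because edges join
consecutive entries of [s]. *)
Lemma spread_reduct_imitate (s : seq V) (c0 c : V -> R) x y : uniq s ->
  consecutive s x y ->
  spread_reduct near_opinions 0 (map c0 s) 0 (map c s) ->
  spread_reduct near_opinions 0 (map c0 s) 0 (map (imitate eps (x, y) c) s).
Proof.
move=> us; set I := imitate _ _ _.
have IE z : z != y -> I z = c z by rewrite /I /imitate => /negbTE ->.
have mapI s' : y \notin s' -> map I s' = map c s'.
  by move=> ys'; apply/eq_in_map => z zs'; apply: IE; apply: contraNneq ys' => <-.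
have Iy : I y = if `|c x - c y| <= eps then c x else c y.
  by rewrite /I /imitate eqxx.
move=> [s1 [s2 [sE|sE]]]; move: us; rewrite {}sE cat_uniq !map_cat /= !inE.
- move=> /and3P[_ /norP[_ /norP[y1 _]] /and3P[/norP[xy _] y2 _]].
  rewrite (mapI s1)// (mapI s2)// (IE x)// Iy.
  by case: ifP => // cl; exact: spread_reduct_right.
- move=> /and3P[_ /norP[y1 _] /and3P[/norP[yx y2] _ _]].
  rewrite (mapI s1)// (mapI s2)// (IE x)// 1?eq_sym// Iy.
  case: ifP => // cl; apply: spread_reduct_left.
  by rewrite /near_opinions distrC.
Qed.

(** Distinct initial opinions stay distinct letters in the word of survivors, so
counting values amounts to counting letters. *)
Lemma nb_opinions_reduct (s : seq V) (c0 c : V -> R) : (forall x, x \in s) ->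
  uniq (map c0 s) ->
  spread_reduct near_opinions 0 (map c0 s) 0 (map c s) ->
  exists2 t, reduces near_opinions 0 (map c0 s) t 0 & size t = nb_opinions c.
Proof.
move=> sV u0 [t st tc]; exists t => //.
have ut : uniq t := subseq_uniq (reduces_subseq st) u0.
apply/eqP; rewrite -(uniq_size_uniq (undup_uniq (codom c))) // => v.
rewrite mem_undup (spreads_mem tc); by apply/codomP/mapP => [[x ->]|[x _ ->]]; exists x.
Qed.

End trajectories.

(** * Rounded initial opinions *)

Section cells.
Variables (R : realType) (n : nat).

(** Truncation at [n] puts the opinion 1 in the last cell, so that the [n.+1] cells
of length [1 / n.+1] cover the closed interval [0, 1]. *)
Definition cell (u : R) : 'I_n.+1 :=
  inord (minn (Num.truncn (u * n.+1%:R)) n).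

Lemma cellE u : cell u = minn (Num.truncn (u * n.+1%:R)) n :> nat.
Proof. by rewrite inordK// ltnS geq_minr. Qed.

Lemma cell_homo u v : u <= v -> (cell u <= cell v)%N.
Proof.
move=> uv; rewrite !cellE leq_min geq_minr andbT geq_min.
by rewrite le_truncn// ler_wpM2r.
Qed.

Lemma truncn_leD1 (x y : R) : x <= y + 1 -> (Num.truncn x <= (Num.truncn y).+1)%N.
Proof.
move=> xy; have [x0|x0] := ltP x 0.
  by have -> : Num.truncn x = 0%N by apply/truncn0Pn; rewrite -ltNge; lra.
rewrite -ltnS truncn_lt_nat//.
have [y0|y0] := ltP y 0; first by rewrite (@lt_le_trans _ _ 1) ?ler1n//; move: xy y0; lra.
have /andP[_ yt] := truncn_itv y0.
by rewrite -natr1 (le_lt_trans xy)// ltrD2r.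
Qed.

Definition adjacent_cells (i j : 'I_n.+1) := (i <= j.+1)%N && (j <= i.+1)%N.

Lemma adjacent_cellsC : symmetric adjacent_cells.
Proof. by move=> i j; rewrite /adjacent_cells andbC. Qed.

Lemma card_adjacent_cells i : (#|adjacent_cells i| <= 3)%N.
Proof.
rewrite cardE -(size_map val).
apply: (@leq_trans (size (iota i.-1 3))) => //.
apply: uniq_leq_size => [|j /mapP[k]].
  by rewrite map_inj_uniq ?enum_uniq//; exact: val_inj.
rewrite mem_enum unfold_in /adjacent_cells mem_iota => /andP[ik ki] ->.
by move: ik ki => /=; case: (nat_of_ord i) => *; lia.
Qed.

(** Cells are at least as long as eps, so nearby opinions are at most one cell
apart. *)
Lemma adjacent_cells_near eps u v : eps * n.+1%:R <= 1 -> `|u - v| <= eps ->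
  adjacent_cells (cell u) (cell v).
Proof.
move=> en uv.
suff cl (x y : R) : x - y <= eps -> (cell x <= (cell y).+1)%N.
  by rewrite /adjacent_cells !cl//; move: uv; rewrite ler_norml; lra.
move=> xy; rewrite !cellE.
have : x * n.+1%:R <= y * n.+1%:R + 1.
  rewrite -lerBlDl -mulrBl (le_trans _ en)// ler_wpM2r//.
move/truncn_leD1; move: (Num.truncn _) (Num.truncn _) => a b; lia.
Qed.

(** [cell] is monotone, so its fibres are intervals. *)
Lemma measurable_cell k : measurable [set u | cell u = k].
Proof.
apply: is_interval_measurable => x y xk yk z /andP[xz zy].
apply/val_inj/eqP; rewrite eqn_leq /=.
by rewrite -{1}yk cell_homo//= -xk cell_homo.
Qed.

Lemma cell_itv u k : 0 <= u <= 1 -> cell u = k ->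
  k%:R / n.+1%:R <= u <= k.+1%:R / n.+1%:R.
Proof.
move=> /andP[u0 u1] uk; have /(congr1 val) /= := uk; rewrite cellE => kE.
have un0 : 0 <= u * n.+1%:R by rewrite mulr_ge0.
have un1 : u * n.+1%:R <= n.+1%:R by rewrite ler_piMl.
have /andP[t1 t2] := truncn_itv un0.
rewrite ler_pdivrMr ?ltr0n// ler_pdivlMr ?ltr0n//; apply/andP; split.
  by rewrite (le_trans _ t1)// ler_nat -kE geq_minl.
rewrite -kE /minn; case: ifP => [_|]; first exact: ltW.
by [].
Qed.

Lemma uniform_prob_cell k :
  (uniform_prob (@ltr01 R) [set u | cell u = k] <= n.+1%:R^-1%:E)%E.
Proof.
have mc := measurable_cell k.
rewrite /uniform_prob integral_uniform_pdf.
rewrite (eq_integral (cst 1%E)); last first.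
  move=> x; rewrite inE => -[_ /=]; rewrite in_itv /= => x01.
  by rewrite /uniform_pdf x01 subr0 invr1.
rewrite integral_cst; last by apply: measurableI => //; exact: measurable_itv.
rewrite mul1e.
apply: (@le_trans _ _ (lebesgue_measure
   (`[(k%:R / n.+1%:R : R), k.+1%:R / n.+1%:R]%classic : set R))).
  apply: le_measure; rewrite ?inE.
  - by apply: measurableI => //; exact: measurable_itv.
  - exact: measurable_itv.
  - by move=> x [xk /=]; rewrite !in_itv /= => x01; exact: cell_itv.
rewrite lebesgue_measure_itv /= lte_fin -EFinB; case: ifP => _ //.
by rewrite lee_fin -mulrBl -natrB// subSnn mul1r.
Qed.

End cells.

Section independent_letters.
Variables (R : realType) (d : measure_display) (T : measurableType d).
Variable P : probability T R.

(** The product rule for an arbitrary injectively indexed subfamily; the events are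
extended by [setT] to the indices outside the image of [g]. *)
Lemma mutually_independent_seq (I : choiceType) (X : I -> {RV P >-> R})
    (J : eqType) (g : J -> I) (s : seq J) (B : J -> set R) :
  mutually_independent X -> injective g -> uniq s ->
  (forall j, measurable (B j)) ->
  P (\bigcap_(j in [set` s]) X (g j) @^-1` B j) =
  (\prod_(j <- s) P (X (g j) @^-1` B j))%E.
Proof.
move=> indep g_inj us mB.
pose B' i := if pselect (exists j, g j = i) is left p then B (projT1 (cid p))
             else setT.
have B'g j : B' (g j) = B j.
  rewrite /B'; case: pselect => [p|]; last by case; exists j.
  by case: cid => j' /= /g_inj ->.
have mB' i : measurable (B' i) by rewrite /B'; case: pselect.
have := indep [fset i in map g s]%fset B' mB'.
have -> : \bigcap_(i in [set` [fset i in map g s]%fset]) X i @^-1` B' i =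
    \bigcap_(j in [set` s]) X (g j) @^-1` B j.
  apply/seteqP; split => w Xw => [j js|i].
    rewrite -B'g; apply: Xw; rewrite /= inE; exact: map_f.
  by rewrite /= inE => /mapP[j js ->]; rewrite /preimage /= B'g; exact: Xw.
move=> ->.
have perm : perm_eq [fset i in map g s]%fset (map g s).
  apply: uniq_perm => [||i]; [exact: fset_uniq | | by rewrite inE].
  by rewrite map_inj_uniq.
by rewrite (perm_big _ perm) big_map; apply: eq_bigr => j _; rewrite B'g.
Qed.

Lemma measurable_eq_RV (X Y : {RV P >-> R}) : measurable [set w | X w = Y w].
Proof.
have := measurable_fun_eqr (measurable_funPT X) (measurable_funPT Y).
move=> /(_ measurableT [set true]) /=; rewrite setTI => h.
rewrite (_ : [set w | _] = (fun w => X w == Y w) @^-1` [set true]).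
  exact: h.
by apply/seteqP; split => w /= /eqP.
Qed.

Lemma measure_le_sum (A : finType) (F : A -> set T) (E : set T) :
  measurable E -> (forall a, measurable (F a)) -> E `<=` \bigcup_a F a ->
  (P E <= \sum_(a : A) P (F a))%E.
Proof.
move=> mE mF EF.
have sub (r : seq A) : measurable (\big[setU/set0]_(a <- r) F a) /\
    (P (\big[setU/set0]_(a <- r) F a) <= \sum_(a <- r) P (F a))%E.
  elim: r => [|a r [mr IH]]; first by rewrite !big_nil measure0.
  rewrite !big_cons; split; first exact: measurableU.
  by apply: le_trans (measureU2 _ _ _) _ => //; exact: leeD2l.
have [mU leU] := sub (index_enum A).
apply: le_trans leU; apply: le_measure; rewrite ?inE//.
rewrite -bigcup_seq => w /EF[a _ Fa]; exists a => //=.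
exact: mem_index_enum.
Qed.

Variables (A : finType) (V : eqType) (L : V -> T -> A).
Hypothesis mL : forall x a, measurable [set w | L x w = a].
(* An upper bound for the probability of each word is enough to compare any event
   with its probability under the uniform law. *)
Hypothesis PL : forall s (g : V -> A), uniq s ->
  (P (\bigcap_(x in [set` s]) [set w | L x w = g x]) <= (#|A|%:R^-1 ^+ size s)%:E)%E.

Lemma measurable_word xs (Q : seq A -> Prop) :
  measurable [set w | Q [seq L x w | x <- xs]].
Proof.
elim: xs Q => [|x xs IH] Q /=.
  have [q|q] := pselect (Q [::]).
    rewrite (_ : [set _ | _] = setT)//.
    by apply/seteqP; split => w.
  by rewrite (_ : [set _ | _] = set0)//; apply/seteqP; split => w.
rewrite (_ : [set _ | _] = \bigcup_(a in [set: A])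
  ([set w | L x w = a] `&` [set w | Q (a :: [seq L y w | y <- xs])])).
  apply: fin_bigcup_measurable => // a _; apply: measurableI => //.
  exact: (IH (fun s => Q (a :: s))).
apply/seteqP; split => [w Qw|w [a _ [/= -> //]]].
by exists (L x w).
Qed.

(** Generalization of [word_prob] by the letters [g] already revealed on [ys], so
that induction on [xs] can move the letters one by one into the prefix. *)
Lemma word_prob_prefix xs ys (g : V -> A) (Q : seq A -> Prop) : uniq (ys ++ xs) ->
  (P (\bigcap_(x in [set` ys]) [set w | L x w = g x] `&`
      [set w | Q [seq L y w | y <- xs]]) <=
   (#|A|%:R^-1 ^+ size ys * prob R (size xs) Q)%:E)%E.
Proof.
have mG (ys' : seq V) g' : measurable (\bigcap_(x in [set` ys']) [set w | L x w = g' x]).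
  by apply: fin_bigcap_measurable => [|x _]; [exact: finite_seq | exact: mL].
elim: xs ys g Q => [|x xs IH] ys g Q uyx.
  rewrite cats0 in uyx; rewrite /prob /=.
  case: asboolP => q; last first.
    rewrite (_ : [set w | Q _] = set0); last by apply/seteqP; split.
    by rewrite setI0 measure0 mulr0.
  rewrite (_ : [set w | Q _] = setT); last by apply/seteqP; split.
  by rewrite setIT mulr1; exact: PL.
pose g' a := fun y => if y == x then a else g y.
pose F a := \bigcap_(y in [set` rcons ys x]) [set w | L y w = g' a y] `&`
   [set w | Q (a :: [seq L y w | y <- xs])].
have uyx' : uniq (rcons ys x ++ xs) by rewrite cat_rcons.
have xys : x \notin ys.
  by move: uyx; rewrite uniq_catC /= mem_cat => /andP[/norP[]].
apply: (@le_trans _ _ (\sum_(a : A) P (F a))%E).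
  apply: measure_le_sum => //.
  - by apply: measurableI => //; exact: measurable_word.
  - move=> a; apply: measurableI => //.
    exact: (measurable_word _ (fun s => Q (a :: s))).
  - move=> w [/= Gw Qw]; exists (L x w) => //; split => //= y /=.
    rewrite mem_rcons inE /g'; case: eqVneq => [->//|yx /= yys].
    exact: Gw.
apply: (@le_trans _ _ (\sum_(a : A) (#|A|%:R^-1 ^+ (size ys).+1 *
    prob R (size xs) (fun s => Q (a :: s)))%:E)%E).
  apply: lee_sum => a _; rewrite -(size_rcons ys x).
  exact: (IH _ (g' a) (fun s => Q (a :: s))).
rewrite sumEFin lee_fin /prob /= -mulr_sumr exprSr -!mulrA.
by rewrite [X in _ <= _ * X]mulrC.
Qed.

Lemma word_prob xs (Q : seq A -> Prop) : uniq xs ->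
  (P [set w | Q [seq L x w | x <- xs]] <= (prob R (size xs) Q)%:E)%E.
Proof.
case: xs => [|x xs] ux.
  rewrite /prob /=; case: asboolP => q.
    by apply: probability_le1; exact: (measurable_word [::] Q).
  by rewrite (_ : [set w | Q _] = set0) ?measure0//; apply/seteqP; split.
have := @word_prob_prefix (x :: xs) [::] (fun _ => L x point) Q ux.
rewrite expr0 mul1r; apply: le_trans.
rewrite (_ : \bigcap_(y in [set` [::]]) _ = setT) ?setTI//.
by apply/seteqP; split => // w _ y.
Qed.

End independent_letters.

Section uniform_opinions.
Variables (R : realType) (d : measure_display) (T : measurableType d).
Variable P : probability T R.
Variables (V : finType) (X : V -> {RV P >-> R}).
Hypothesis X_law : forall x, has_law (X x) (uniform_prob (@ltr01 R)).
Hypothesis X_indep : forall (s : seq V) (B : V -> set R), uniq s ->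
  (forall x, measurable (B x)) ->
  P (\bigcap_(x in [set` s]) X x @^-1` B x) = (\prod_(x <- s) P (X x @^-1` B x))%E.

Lemma measurable_cell_RV n x k : measurable [set w | cell n (X x w) = k].
Proof. exact: (measurable_funPTI (X x) (measurable_cell k)). Qed.

Lemma cell_word_prob n xs (Q : seq 'I_n.+1 -> Prop) : uniq xs ->
  (P [set w | Q [seq cell n (X x w) | x <- xs]] <= (prob R (size xs) Q)%:E)%E.
Proof.
apply: (word_prob (L := fun x w => cell n (X x w))) => [x k|s g us].
  exact: measurable_cell_RV.
have -> : \bigcap_(x in [set` s]) [set w | cell n (X x w) = g x] =
  \bigcap_(x in [set` s]) X x @^-1` [set u | cell n u = g x] by [].
rewrite X_indep// => [|x]; last exact: measurable_cell.
elim: s {us} => [|x s IH]; first by rewrite big_nil.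
rewrite big_cons /= exprS EFinM; apply: lee_pmul;
  [exact: measure_ge0 | exact: prode_ge0 | | exact: IH].
have := X_law x (measurable_cell (g x)).
rewrite /distribution /pushforward => ->; rewrite card_ord.
exact: uniform_prob_cell.
Qed.

(** Two equal opinions share their cell, whatever the number [n.+1] of cells, which
has probability at most [1 / n.+1]. *)
Lemma distinct_opinions x y : x != y -> {ae P, forall w, X x w <> X y w}.
Proof.
move=> xy.
have mE := measurable_eq_RV (X x) (X y).
suff PE : P [set w | X x w = X y w] = 0%E.
  exists [set w | X x w = X y w]; split => //.
  by move=> w /= /contrapT.
apply/eqP; rewrite eq_le measure_ge0 andbT.
apply/lee_addgt0Pr => eps eps0; rewrite add0e.
have [n] : exists n : nat, n.+1%:R^-1 <= eps.
  exists (Num.truncn eps^-1); rewrite invf_ple ?posrE ?ltr0n//.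
  have ei0 : 0 <= eps^-1 by rewrite invr_ge0 ltW.
  by have /andP[_ /ltW] := truncn_itv ei0.
rewrite -lee_fin; apply: le_trans.
pose Q (s : seq 'I_n.+1) := exists a, s = [:: a; a].
apply: (@le_trans _ _ (P [set w | Q [seq cell n (X z w) | z <- [:: x; y]]])).
  apply: le_measure; rewrite ?inE//.
    apply: (measurable_word (L := fun x w => cell n (X x w))) => z k.
    exact: measurable_cell_RV.
  by move=> w /= ->; exists (cell n (X y w)).
apply: le_trans (cell_word_prob _ _) _; first by rewrite /= inE xy.
rewrite lee_fin /prob /= card_ord.
rewrite ler_pdivrMr ?ltr0n// mulVf ?pnatr_eq0// (_ : \sum_k _ = \sum_(k < n.+1) n.+1%:R^-1).
  by rewrite sumr_const card_ord -[leLHS]mulr_natr mulVf ?pnatr_eq0.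
apply: eq_bigr => a _; rewrite (bigD1 a)//= asboolT; last by exists a.
rewrite big1 ?addr0 ?mul1r// => b ba; rewrite asboolF// => -[c [ac bc]].
by move: ba; rewrite bc ac eqxx.
Qed.

End uniform_opinions.

(** * Clocks and measurability *)

Section clocks.
Variable R : realType.

(** The density is at most 1 on the half-line and vanishes before 0. *)
Lemma exponential_prob_lt (c : R) : 0 <= c ->
  (exponential_prob 1 `]-oo, c[%classic <= c%:E)%E.
Proof.
move=> c0.
have mB : measurable (`]-oo, c[%classic : set R) by exact: measurable_itv.
have mE : measurable (`[0, c[%classic : set R) by exact: measurable_itv.
apply: (@le_trans _ _
  (\int[lebesgue_measure]_(x in `]-oo, c[%classic) (\1_(`[0%R, c[%classic) x : R)%:E)%E).
  apply: ge0_le_integral => //.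
  - by move=> x _; rewrite lee_fin exponential_pdf_ge0.
  - apply/measurable_EFinP/measurable_funTS; exact: measurable_exponential_pdf.
  - by apply/measurable_EFinP/measurable_funTS; exact: measurable_indic.
  move=> x /=; rewrite in_itv /= => xc; rewrite lee_fin.
  have [x0|x0] := ltP x 0; first by rewrite lt0_exponential_pdf.
  rewrite exponential_pdfE// indicE mem_set/= ?in_itv/= ?x0//.
  by rewrite mul1r mulN1r -expR0 ler_expR oppr_le0.
rewrite integral_indic// setIidl; last first.
  by move=> x /=; rewrite !in_itv /= => /andP[].
apply: (@le_trans _ _ (lebesgue_measure (`[0%R, c[%classic : set R))) => //.
by rewrite lebesgue_measure_itv /= lte_fin sube0; case: ifP.
Qed.

Lemma arrival_diverges (tau : nat -> R) : (forall k, 0 <= tau k) ->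
  (forall n, exists2 k, (n <= k)%N & 2^-1 <= tau k) ->
  forall t, exists n0, forall n, (n0 <= n)%N -> t < arrival tau n.
Proof.
move=> tau0 big t.
have mono m n : (m <= n)%N -> arrival tau m <= arrival tau n.
  move=> mn; rewrite /arrival [leRHS](big_cat_nat (n := m.+1))//= lerDl.
  exact: sumr_ge0.
suff [n0 n0t] : exists n0, t < arrival tau n0.
  by exists n0 => n /mono; apply: lt_le_trans.
have grows m : exists n0, m%:R / 2 <= arrival tau n0.
  elim: m => [|m [n0 IH]].
    by exists 0%N; rewrite mul0r; exact: sumr_ge0.
  have [k n0k tk] := big n0.+1; exists k.
  case: k n0k tk => // k n0k tk; rewrite /arrival big_nat_recr//=.
  rewrite -natr1 mulrDl mul1r lerD//; apply: le_trans IH _; exact: mono.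
have [n0 h] := grows (Num.truncn (t * 2)).+1; exists n0.
apply: lt_le_trans h; rewrite ltr_pdivlMr//.
have [t0|t0] := ltP (t * 2) 0; first by rewrite (lt_le_trans t0).
by have /andP[] := truncn_itv t0.
Qed.

Variables (d : measure_display) (T : measurableType d) (P : probability T R).
Variable tau : nat -> {RV P >-> R}.
Hypothesis tau_law : forall n, has_law (tau n) (@exponential_prob R 1).
Hypothesis tau_indep : forall (s : seq nat) (B : nat -> set R), uniq s ->
  (forall k, measurable (B k)) ->
  P (\bigcap_(k in [set` s]) tau k @^-1` B k) = (\prod_(k <- s) P (tau k @^-1` B k))%E.

Lemma prob_gap_lt c k : 0 <= c -> (P (tau k @^-1` `]-oo, c[%classic) <= c%:E)%E.
Proof.
move=> c0; have := tau_law k (measurable_itv `]-oo, c[).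
by rewrite /distribution /pushforward => ->; exact: exponential_prob_lt.
Qed.

(** Almost surely infinitely many gaps are at least 1/2: the event that the [m] gaps
from index [n] on are all smaller has probability at most [2 ^- m]. *)
Lemma ae_arrival_diverges : {ae P, forall w, forall t, exists n0, forall n,
  (n0 <= n)%N -> t < arrival (fun k => tau k w) n}.
Proof.
have mtau c k : measurable (tau k @^-1` `]-oo, c[%classic).
  exact: (measurable_funPTI (tau k) (measurable_itv _)).
have ge0 : {ae P, forall w, forall k, 0 <= tau k w}.
  apply: ae_foralln => k; exists (tau k @^-1` `]-oo, 0[%classic); split => //.
    by apply/eqP; rewrite eq_le measure_ge0 andbT prob_gap_lt.
  by move=> w /= /negP; rewrite -ltNge in_itv.
have large : {ae P, forall w, forall n, exists2 k, (n <= k)%N & 2^-1 <= tau k w}.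
  apply: ae_foralln => n.
  pose small m := \bigcap_(k in [set` iota n m]) tau k @^-1` `]-oo, 2^-1[%classic.
  have msmall m : measurable (small m).
    by apply: fin_bigcap_measurable => [|k _]; [exact: finite_seq | exact: mtau].
  have Psmall m : (P (small m) <= (2^-1 ^+ m)%:E)%E.
    rewrite /small tau_indep ?iota_uniq//.
    rewrite -{2}(size_iota n m); elim: (iota n m) => [|k s IH].
      by rewrite big_nil expr0.
    rewrite big_cons exprS EFinM.
    apply: lee_pmul;
      [exact: measure_ge0 | exact: prode_ge0 | | exact: IH].
    exact: prob_gap_lt.
  have mS : measurable (\bigcap_m small m) by exact: bigcapT_measurable.
  exists (\bigcap_m small m); split => //.
    apply/eqP; rewrite eq_le measure_ge0 andbT.
    apply/lee_addgt0Pr => eps eps0; rewrite add0e.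
    have [m hm] : exists m, 2^-1 ^+ m <= eps.
      exists (Num.truncn eps^-1); set m := Num.truncn _.
      have ei0 : 0 <= eps^-1 by rewrite invr_ge0 ltW.
      rewrite exprVn invf_ple ?posrE ?exprn_gt0//.
      have /andP[_ /ltW em] := truncn_itv ei0; apply: le_trans em _.
      by rewrite -natrX ler_nat ltn_expl.
    apply: (@le_trans _ _ (P (small m))).
      by apply: le_measure; rewrite ?inE// => w; exact.
    by apply: le_trans (Psmall m) _; rewrite lee_fin.
  move=> w /= h m _ k /=; rewrite mem_iota in_itv /= => /andP[nk _].
  by rewrite ltNge; apply/negP => tk; apply: h; exists k.
near=> w; apply: arrival_diverges; by near: w.
Unshelve. all: by end_near. Qed.

End clocks.

Section measurable_nu.
Variables (R : realType) (d : measure_display) (T : measurableType d).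
Variables (P : probability T R) (V : finType) (eta : R -> V -> {RV P >-> R}).

(** The number of distinct entries of a list is computed by comparing each entry
with the later ones, which are finitely many measurable tests. *)
Lemma measurable_nb_opinions t k :
  measurable [set w | nb_opinions (fun x => eta t x w) = k].
Proof.
rewrite /nb_opinions /codom /image_mem.
elim: (enum _) k => [|x s IH] k.
  have [->|k0] := eqVneq k 0%N.
    by rewrite (_ : [set w | _] = setT)//; apply/seteqP; split.
  rewrite (_ : [set w | _] = set0)//; apply/seteqP; split => // w /= /esym/eqP.
  by rewrite (negbTE k0).
pose M := [set w | eta t x w \in [seq eta t y w | y <- s]].
have mM : measurable M.
  rewrite (_ : M = \bigcup_(y in [set` s]) [set w | eta t x w = eta t y w]).
    apply: fin_bigcup_measurable => [|y _]; first exact: finite_seq.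
    exact: measurable_eq_RV.
  apply/seteqP; split => w /= => [/mapP[y ys yE]|[y ys yE]]; first by exists y.
  by apply/mapP; exists y.
rewrite (_ : [set w | _] =
  (M `&` [set w | size (undup [seq eta t y w | y <- s]) = k]) `|`
  (~` M `&` [set w | (size (undup [seq eta t y w | y <- s])).+1 = k])); last first.
  apply/seteqP; split => w /=; rewrite /M /=.
    by case: ifP => [|/negP]; [left | right].
  by case: ifP => xs [] // [].
apply: measurableU; apply: measurableI => //; first exact: measurableC.
case: k => [|k].
  by rewrite (_ : [set w | _] = set0)//; apply/seteqP; split.
rewrite (_ : [set w | _] = [set w | size (undup [seq eta t y w | y <- s]) = k])//.
by apply/seteqP; split => w /= [->].
Qed.

Hypothesis pj : forall w, pure_jump (fun t x => eta t x w).

(** An integer-valued function converges only by being eventually constant, and by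
right-continuity rational times detect this; the right-hand side is built from
countably many events. *)
Lemma nb_opinions_cvgP w (l : R) :
  (nb_opinions (fun x => eta t x w))%:R @[t --> +oo] --> l <->
  exists2 k : nat, l = k%:R & exists n : nat, forall q : rat,
    n%:R < ratr q :> R -> nb_opinions (fun x => eta (ratr q) x w) = k.
Proof.
set nb := fun t => nb_opinions (fun x => eta t x w).
split => [cv|[k -> [n nE]]]; last first.
  apply: cvg_near_cst; near=> t; congr (_%:R).
  have nt : n%:R < t by near: t; apply: nbhs_pinfty_gt; exact: num_real.
  have /nbhs_ballP[/= e e0 he] := (pj w).1 t (le_trans (ler0n _ _) (ltW nt)).
  have [q] : exists q, ratr q \in `]t, (t + e)[ by apply: rat_in_itvoo; rewrite ltrDl.
  rewrite in_itv /= => /andP[tq qe].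
  rewrite -(nE q) ?(lt_trans nt)//; congr nb_opinions; symmetry; apply: he => //.
  by rewrite -ball_normE /ball_ /= distrC gtr0_norm ?subr_gt0// ltrBlDl.
have [M [_ hM]] : \forall t \near +oo, `|l - (nb t)%:R| < 2^-1.
  by move/cvgrPdist_lt : cv; apply; rewrite invr_gt0.
have same t t' : M < t -> M < t' -> nb t = nb t'.
  move=> /hM /= + /hM /=; rewrite !ltr_norml => h h'.
  have ltF a b : (a < b)%N -> - 2^-1 < l - a%:R < 2^-1 ->
      - 2^-1 < l - b%:R < 2^-1 -> False.
    by rewrite -(ler_nat R) -natr1; lra.
  by case: (ltngtP (nb t) (nb t')) => // /ltF; case.
pose n := (Num.truncn `|M|).+1.
have Mn : M < n%:R.
  by apply: le_lt_trans (ler_norm _) _; have /andP[] := truncn_itv (normr_ge0 M).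
exists (nb n%:R).
  have /cvg_lim <- // := cv.
  apply/cvg_lim => //; apply: cvg_near_cst; near=> t; congr (_%:R).
  by apply: same => //; near: t; apply: nbhs_pinfty_gt; exact: num_real.
by exists n => q nq; apply: same => //; exact: lt_trans nq.
Unshelve. all: by end_near. Qed.

Lemma measurable_nu_lt (r : R) : measurable [set w | nu eta w < r].
Proof.
pose C (k : nat) := [set w | exists n : nat, forall q : rat,
    n%:R < ratr q :> R -> nb_opinions (fun x => eta (ratr q) x w) = k].
have mC k : measurable (C k).
  rewrite (_ : C k = \bigcup_n \bigcap_(q in [set: rat]) [set w | n%:R < ratr q :> R ->
      nb_opinions (fun x => eta (ratr q) x w) = k]).
    apply: bigcupT_measurable => n; rewrite -[X in measurable X]setCK setC_bigcap.
    apply: measurableC; apply: bigcupT_measurable_rat => q; apply: measurableC.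
    have [nq|nq] := pselect (n%:R < ratr q :> R).
      rewrite (_ : [set w | _] = [set w | nb_opinions (fun x => eta (ratr q) x w) = k]).
        exact: measurable_nb_opinions.
      by apply/seteqP; split => w /=; auto.
    rewrite (_ : [set w | _] = setT)//.
    by apply/seteqP; split => w //= _ /nq.
  apply/seteqP; split => [w [n h]|w [n _ h]]; exists n => // q; last exact: h.
  by move=> _; exact: h.
pose D := \bigcup_k C k.
have mD : measurable D by exact: bigcupT_measurable.
have nuC w k : C k w -> nu eta w = k%:R.
  by move=> Ck; apply/cvg_lim => //; apply/nb_opinions_cvgP; exists k.
have nuD w : ~ D w -> nu eta w = point.
  move=> nD; apply: dvgP => /cvg_ex[l /nb_opinions_cvgP[k _ Ck]].
  by apply: nD; exists k.
(* Where the number of opinions has no limit, nu is the default value point. *)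
have [pr|pr] := pselect ((point : R) < r).
  rewrite (_ : [set w | _] = (\bigcup_(k in [set k : nat | k%:R < r]) C k) `|` ~` D).
    by apply: measurableU; [exact: bigcup_measurable | exact: measurableC].
  apply/seteqP; split => w.
    move=> /= nur; have [[k _ Ck]|nD] := pselect (D w); last by right.
    by left; exists k => //=; rewrite -(nuC w k).
  by move=> [[k /= kr /nuC ->//]|/nuD /= ->].
rewrite (_ : [set w | _] = \bigcup_(k in [set k : nat | k%:R < r]) C k).
  exact: bigcup_measurable.
apply/seteqP; split => w.
  move=> /= nur; have [[k _ Ck]|/nuD nuw] := pselect (D w).
    by exists k => //=; rewrite -(nuC w k).
  by exfalso; apply: pr; rewrite -nuw.
by move=> [k /= kr /nuC ->].
Qed.

End measurable_nu.

(** * The number of surviving opinions *)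

(** Almost surely, the number of opinions at equilibrium is the length of some
reduction of the initial word, with arbitrary walls (here 0) at its ends. *)
Lemma ae_nu_reduct (R : realType) (d : measure_display) (T : measurableType d)
    (P : probability T R) (V : finType) (e : rel V) (eps : R)
    (tau : adjpair e -> nat -> {RV P >-> R}) (eta : R -> V -> {RV P >-> R})
    (s : seq V) :
  opinion_dynamics eps tau eta -> uniq s -> (forall x, x \in s) ->
  (forall x y, e x y -> consecutive s x y) ->
  {ae P, forall w, exists2 t,
    reduces (near_opinions eps) 0 [seq eta 0 x w | x <- s] t 0 &
    nu eta w = (size t)%:R}.
Proof.
move=> [_ pj X_law tau_law indep ring no_ring] us s_all s_consec.
have far : {ae P, forall w, forall a t, exists n0, forall n,
    (n0 <= n)%N -> t < arrival (fun k => tau a k w) n}.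
  apply: filter_forall => a; apply: ae_arrival_diverges => [n|s' B us' mB].
    exact: tau_law.
  have g_inj : injective (fun k : nat => inr (a, k) : V + adjpair e * nat).
    by move=> k k' [].
  exact: (mutually_independent_seq indep g_inj us' mB).
have distinct : {ae P, forall w, forall x y, x != y -> eta 0 x w <> eta 0 y w}.
  apply: filter_forall => x; apply: filter_forall => y.
  have [->|xy] := eqVneq x y; first exact: aeW.
  have inl_inj : injective (inl : V -> V + adjpair e * nat) by move=> ? ? [].
  have D := distinct_opinions X_law _ xy.
  apply: filterS (D _) => [w Dw _ //|s' B us' mB].
  exact: (mutually_independent_seq indep inl_inj us' mB).
near=> w.
have jump t : 0 < t -> (\forall s \near t^'-,
      (fun x => eta t x w) = (fun x => eta s x w)) \/
    exists a : adjpair e, \forall s \near t^'-,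
      (fun x => eta t x w) = imitate eps (val a) (fun x => eta s x w).
  apply: (jump_is_imitation (f := fun t x => eta t x w)
    (arr := fun a n => arrival (fun k => tau a k w) n)).
  - by near: w.
  - by near: w.
  - by near: w.
have [t t0 nuE] := nu_attained (eta := fun t x w => eta t x w) (pj w) jump.
have red : spread_reduct (near_opinions eps) 0 [seq eta 0 x w | x <- s] 0
    [seq eta t x w | x <- s].
  apply: (opinion_induction (f := fun t x => eta t x w)
    (Inv := fun c => spread_reduct (near_opinions eps) 0
       [seq eta 0 x w | x <- s] 0 (map c s)) (pj w) jump (lexx 0)) => //.
    exists [seq eta 0 x w | x <- s]; first exact: reduces_refl.
    exact: spreads_refl.
  by move=> x y c /s_consec; exact: spread_reduct_imitate.
have uX : uniq [seq eta 0 x w | x <- s].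
  rewrite map_inj_in_uniq// => x y _ _ xy; apply/eqP; apply: contraT => xNy.
  have Dw : forall x y, x != y -> eta 0 x w <> eta 0 y w by near: w.
  by case: (Dw _ _ xNy).
have [u ru uE] := nb_opinions_reduct s_all uX red.
by exists u => //; rewrite uE; exact: nuE.
Unshelve. all: by end_near. Qed.

(** The arithmetic behind the constants: [N + 1 <= 2 N] turns 48 into 96, and the
remaining [+ 1] provides the decay rate. *)
Lemma exponent_le (R : realFieldType) (a eps N m : R) :
  (96 * a + 1) * eps * N <= m -> 0 <= a * eps * (N - 1) ->
  (N + 1) * (48 * (a * eps)) - m <= - (eps * N).
Proof. lra. Qed.

Theorem theorem1p8 (R : realType) :
  exists c1 c2 : R, 0 < c1 /\ 0 < c2 /\
  forall (N : nat) (V : finType) (e : rel V),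
    #|V| = N -> is_path e ->
  forall eps : R, 0 <= eps <= 1 ->
  forall (d : measure_display) (T : measurableType d) (P : probability T R)
    (tau : adjpair e -> nat -> {RV P >-> R}) (eta : R -> V -> {RV P >-> R}),
    opinion_dynamics eps tau eta ->
    (P [set w | (nu eta w < (1 - c1 * eps) * N%:R)%R] <=
       (expR (- (c2 * eps * N%:R)))%:E)%E.
Proof.
have [e1 e1E] : exists e1 : R, e1 = expR 1 by exists (expR 1).
have e1_ge1 : 1 <= e1 by rewrite e1E -expR0 ler_expR.
(* 96 = 2 * 48 with 48 = 4 * 12, where 12 eps bounds kappa = 6 / K and the factor
   2 comes from N + 1 <= 2 N. *)
exists (96 * e1 + 1), 1; split; first lra; split => // N V e VN pathG eps.
move=> /andP[eps0 eps1] d T P tau eta dyn.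
have [s [us s_all s_consec]] := is_path_enum pathG.
have sN : size s = N.
  by rewrite -VN -(card_uniqP us); apply: eq_card => x; rewrite s_all.
have N0 : (0 < N)%N.
  have [_ _ leaves _] := pathG.
  have /card_gt0P[u _] : (0 < #|[set x | degree e x == 1%N]%SET|)%N.
    by rewrite leaves.
  by rewrite -VN; apply/card_gt0P; exists u.
set r := (1 - _) * _; set E := [set w | _].
have mE : measurable E by apply: measurable_nu_lt; exact: od_pure_jump dyn.
move: eps0; rewrite le_eqVlt => /orP[/eqP eps0|eps0].
  rewrite -eps0 mulr0 mul0r oppr0 expR0; exact: probability_le1.
have [A [mA PA badA]] := ae_nu_reduct dyn us s_all s_consec.
(* The number of cells is K = n.+1 = floor (1 / eps): the largest for which cells
   are not shorter than eps. *)
pose n := (Num.truncn eps^-1).-1.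
have nE : n.+1 = Num.truncn eps^-1.
  rewrite /n prednK// truncn_gt0 -invr1 lef_pV2 ?posrE//.
have epsn : eps * n.+1%:R <= 1.
  have ei0 : 0 <= eps^-1 by rewrite invr_ge0 ltW.
  have /andP[+ _] := truncn_itv ei0; rewrite -nE.
  by rewrite -(ler_pM2l eps0) mulfV ?gt_eqF.
have ngt : n.+1%:R^-1 <= 2 * eps.
  have ei0 : 0 <= eps^-1 by rewrite invr_ge0 ltW.
  have /andP[_ +] := truncn_itv ei0; rewrite -nE.
  rewrite invf_ple ?posrE ?mulr_gt0 ?ltr0n// invfM => h.
  have n1 : (1 : R) <= n.+1%:R by rewrite ler1n.
  move: h; rewrite -natr1; lra.
pose m := (Num.truncn ((96 * e1 + 1) * eps * N%:R)).+1.
pose Q (u : seq 'I_n.+1) :=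
  lost (@adjacent_cells n) (cell n (0 : R)) m u (cell n (0 : R)).
pose W := [set w | Q [seq cell n (eta 0 x w) | x <- s]].
have mW : measurable W.
  apply: (measurable_word (L := fun x w => cell n (eta 0 x w))) => x k.
  exact: measurable_cell_RV.
have cN0 : 0 <= (96 * e1 + 1) * eps * N%:R.
  by rewrite !mulr_ge0// 1?ltW//; lra.
have /andP[m1 m2] := truncn_itv cN0.
have EAW : E `<=` A `|` W.
  move=> w Ew; have [|nA] := pselect (A w); [by left | right].
  have [t redt nuE] := contrapT (fun g => nA (badA w g)).
  exists (map (cell n) t).
    have := reduces_map (f := cell n) (closeB := @adjacent_cells n) _ redt.
    rewrite -map_comp; apply => a b; exact: adjacent_cells_near.
  rewrite !size_map sN.
  move: Ew; rewrite /E /= nuE /r => Ew.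
  by rewrite /m addnS -(ltr_nat R) natrD; lra.
have le_W : (P E <= P W)%E.
  have -> : P W = (P A + P W)%E by rewrite PA add0e.
  apply: le_trans (measureU2 P mA mW).
  by apply: le_measure; rewrite ?inE//; exact: measurableU.
apply: le_trans le_W _.
have PW : (P W <= (prob R N Q)%:E)%E.
  rewrite -sN; apply: cell_word_prob => // [x|s' B us' mB].
    exact: od_initial_law dyn x.
  have inl_inj : injective (inl : V -> V + adjpair e * nat) by move=> ? ? [].
  exact: (mutually_independent_seq (od_independent dyn) inl_inj us' mB).
apply: le_trans PW _; rewrite lee_fin.
(* If c1 eps >= 1 more than N letters would have to be lost; otherwise eps is small
   enough for theta = e to satisfy 4 kappa theta <= 1. *)
have [large|small] := leP 1 ((96 * e1 + 1) * eps).
  rewrite prob_eq0 ?expR_ge0// => u uN [t _]; rewrite uN => tm.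
  have mN : (m <= N)%N by apply: leq_trans tm; exact: leq_addl.
  move: m2; apply/negP; rewrite -leNgt (@le_trans _ _ N%:R) ?ler_nat//.
  by rewrite ler_peMl.
have kappa_le : kappa R 'I_n.+1 3 <= 12 * eps.
  rewrite /kappa card_ord (_ : 3.*2 = 6)%N//.
  by move: (n.+1%:R^-1 : R) ngt => x; lra.
have e1eps : 0 <= e1 * eps by rewrite mulr_ge0 ?(ltW eps0)//; lra.
have kt_le : 4 * kappa R 'I_n.+1 3 * e1 <= 48 * (e1 * eps).
  have e1_ge0 : 0 <= e1 by lra.
  by have := ler_wpM2r e1_ge0 kappa_le; lra.
have kt1 : 4 * kappa R 'I_n.+1 3 * e1 <= 1 by move: small kt_le eps0 e1eps; lra.
have T0 : (0 < #|'I_n.+1|)%N by rewrite card_ord.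
have := prob_lost T0 (@adjacent_cellsC n) (@card_adjacent_cells n) e1_ge1 kt1
  N (cell n (0 : R)) (cell n (0 : R)) m.
rewrite -/Q {1}e1E -expRM_natl mulr1 mulrC.
rewrite -ler_pdivlMr ?expR_gt0// -expRN => /le_trans; apply.
have growth_le : growth 'I_n.+1 3 e1 <= expR (48 * (e1 * eps)).
  by apply: le_trans (expR_ge1Dx _); rewrite /growth lerD2l.
have growth0 : 0 <= growth 'I_n.+1 3 e1.
  by rewrite (le_trans ler01)// growth_ge1.
apply: (@le_trans _ _ (expR (N.+1%:R * (48 * (e1 * eps))) * expR (- m%:R))).
  rewrite expRM_natl ler_wpM2r ?expR_ge0//.
  by apply: lerXn2r; rewrite ?nnegrE ?expR_ge0.
rewrite -expRD ler_expR -natr1 mul1r.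
have N1 : (1 : R) <= N%:R by rewrite ler1n.
have : 0 <= (e1 * eps) * (N%:R - 1) by rewrite mulr_ge0 ?subr_ge0.
move: (ltW m2); rewrite -/m; exact: exponent_le.
Qed.
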